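(* Let $n\ge 3$ be an integer. If $n \geq 3$ is odd, then $\mathrm{ParseWords}(\mathrm{LeftCombTree}(n), \mathrm{LeftCrookedTree}(n))$ equals \[\left\{ \mathrm{mod}(2-n,3) \left((012)^{(n-1)/6}\right)^R (012)^{(n-3)/6}\, \mathrm{mod}(2-n,3),\;\; \mathrm{mod}(2-n,3) \left((012)^{(n-1)/6}\right)^R (012)^{(n-3)/6}\, \mathrm{mod}(-n,3) \right\},\] and if $n \geq 4$ is even, then $\mathrm{ParseWords}(\mathrm{LeftCombTree}(n), \mathrm{LeftCrookedTree}(n))$ equals \[\left\{ \mathrm{mod}(2-n,3) \left((012)^{(n-4)/6}\right)^R (012)^{n/6}\, \mathrm{mod}(2-n,3),\;\; \mathrm{mod}(2-n,3) \left((012)^{(n-4)/6}\right)^R (012)^{n/6}\, \mathrm{mod}(-n,3) \right\}.\] (Sets of equivalence classes are written by listing one representative of each class; juxtaposition is concatenation, each value $\mathrm{mod}(\cdot,3)\in\{0,1,2\}$ being a single letter.)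
   Context: A binary tree is a rooted ordered tree in which each vertex has either $0$ or $2$ children; its leaves are ordered left to right. Let $G$ be the context-free grammar with start symbols $0,1,2$ and rules $0\to 12$, $0\to 21$, $1\to 02$, $1\to 20$, $2\to 01$, $2\to 10$. An $n$-leaf binary tree $T$ parses a word $w$ of length $n$ on $\{0,1,2\}$ if there is a labeling of the vertices of $T$ by $0,1,2$ such that the leaves, from left to right, are labeled with the letters of $w$, and at every internal vertex the label of the vertex together with the labels of its left and right children form a rule of $G$ (i.e. the three labels are pairwise distinct). If $T$ parses $w$, it also parses every word obtained from $w$ by permuting the alphabet $\{0,1,2\}$. For $n$-leaf binary trees $T_1,T_2$, $\mathrm{ParseWords}(T_1,T_2)$ denotes the set of equivalence classes (under permutations of the alphabet $\{0,1,2\}$) of words parsed by both $T_1$ and $T_2$; it is written by listing one representative of each class. If $w=w_1\cdots w_m$ is a word of length $m$ and $x\ge 0$ is a rational number whose denominator in lowest terms divides $m$, then $w^x = w^{\lfloor x\rfloor} w_1 w_2\cdots w_{m(x-\lfloor x\rfloor)}$ is the word of length $mx$ consisting of repeated copies of $w$ truncated at $mx$ letters. $w^R$ is the left–right reversal of $w$. $\mathrm{mod}(a,3)$ is the smallest nonnegative integer congruent to $a$ modulo $3$. The level of a vertex is its distance from the root. A path tree is a binary tree with at most two vertices on each level. For $n\ge 2$, $n$-leaf path trees correspond bijectively to words $x_1\cdots x_{n-2}$ on $\{l,r\}$: $x_j=l$ (resp. $x_j=r$) means that, of the two vertices on level $j$, the left (resp. right) one has children. $\mathrm{LeftCombTree}(n)$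 is the $n$-leaf path tree corresponding to $l^{n-2}$. $\mathrm{LeftCrookedTree}(n)$ is the $n$-leaf path tree corresponding to $(lr)^{(n-2)/2}$, i.e. the word $lrlr\cdots$ of length $n-2$. *)

(* Defs.v *)
From mathcomp Require Import all_boot all_order all_algebra all_fingroup.
From mathcomp Require Import classical_sets.

Set Implicit Arguments.
Unset Strict Implicit.
Unset Printing Implicit Defensive.

Import Order.TTheory GRing.Theory Num.Theory.
Local Open Scope ring_scope.

Inductive btree : Type := Leaf | Node of btree & btree.

Fixpoint leaves (T : btree) : nat :=
  if T is Node T1 T2 then (leaves T1 + leaves T2)%N else 1%N.

(* Subtrees rooted at the vertices of level j, from left to right. *)
Fixpoint level (T : btree) (j : nat) {struct j} : seq btree :=
  match j, T with
  | 0%N, _ => [:: T]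
  | j'.+1, Leaf => [::]
  | j'.+1, Node T1 T2 => level T1 j' ++ level T2 j'
  end.

Definition is_path_tree (T : btree) : Prop :=
  forall j : nat, (size (level T j) <= 2)%N.

Definition letter : Type := 'I_3.
Definition word : Type := seq letter.

(* (a, b, c) is the rule a -> b c. *)
Definition grammar : seq ('I_3 * 'I_3 * 'I_3) :=
  [:: (0, 1, 2); (0, 2, 1); (1, 0, 2); (1, 2, 0); (2, 0, 1); (2, 1, 0)].

(* Trees all of whose vertices carry a letter; a labeling of T is an ltree of
   shape T. *)
Inductive ltree : Type := LLeaf of letter | LNode of letter & ltree & ltree.

Definition label (L : ltree) : letter :=
  match L with LLeaf a => a | LNode a _ _ => a end.

Fixpoint shape (L : ltree) : btree :=
  if L is LNode _ L1 L2 then Node (shape L1) (shape L2) else Leaf.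

Fixpoint frontier (L : ltree) : word :=
  match L with
  | LLeaf a => [:: a]
  | LNode _ L1 L2 => frontier L1 ++ frontier L2
  end.

Fixpoint follows_rules (L : ltree) : bool :=
  match L with
  | LLeaf _ => true
  | LNode a L1 L2 =>
      [&& (a, label L1, label L2) \in grammar,
          follows_rules L1 & follows_rules L2]
  end.

Definition parses (T : btree) (w : word) : Prop :=
  exists L : ltree, [/\ shape L = T, frontier L = w & follows_rules L].

Definition word_class (w : word) : set word :=
  [set v | exists s : {perm 'I_3}, v = map s w]%classic.

Definition ParseWords (T1 T2 : btree) : set (set word) :=
  [set word_class w | w in [set w | parses T1 w /\ parses T2 w]]%classic.

(* w^x; meaningful when 0 <= x and (size w) * x is an integer, in which case
   the argument of the outer truncn is a natural number. *)
Definition wpow (A : Type) (w : seq A) (x : rat) : seq A :=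
  flatten (nseq (Num.truncn x) w) ++
  take (Num.truncn ((size w)%:R * (x - (Num.truncn x)%:R))) w.

Definition mod3 (a : int) : letter := inord `|(a %% 3)%Z|%N.

Definition w012 : word := [:: 0; 1; 2].

Inductive dir : Type := dl | dr.

(* The j-th direction (from 1) tells which of the two vertices of level j has
   children; the empty word gives the 2-leaf tree. *)
Fixpoint path_tree (s : seq dir) : btree :=
  match s with
  | [::] => Node Leaf Leaf
  | dl :: s' => Node (path_tree s') Leaf
  | dr :: s' => Node Leaf (path_tree s')
  end.

Lemma leaves_path_tree (s : seq dir) : leaves (path_tree s) = (size s).+2.
Proof. by elim: s => [|[] s IHs] //=; rewrite IHs ?addn1 ?add1n. Qed.

Lemma is_path_tree_path_tree (s : seq dir) : is_path_tree (path_tree s).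
Proof.
rewrite /is_path_tree; elim: s => [|d s IHs] j; first by case: j => [|[|[]]].
case: j => [|j] //; have := IHs j.
by case: d; rewrite /= size_cat; case: j => [|j] //=; rewrite addn0.
Qed.

Lemma level_path_tree (s : seq dir) (j : nat) : (j < size s)%N ->
  exists T1 T2 : btree, level (path_tree s) j.+1 =
    match nth dl s j with
    | dl => [:: Node T1 T2; Leaf]
    | dr => [:: Leaf; Node T1 T2]
    end.
Proof.
have nodeE t : exists T1 T2, path_tree t = Node T1 T2.
  by case: t => [|[] t]; do 2!eexists.
elim: s j => [|d s IHs] [|j] lt_js //.
  by case: (nodeE s) => T1 [T2 eqT]; exists T1, T2; case: d lt_js; rewrite /= eqT.
have [T1 [T2 eqT]] := IHs j lt_js; exists T1, T2.
by case: d lt_js => _; rewrite -[nth _ _ _]/(nth dl s j) -eqT //= cats0.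
Qed.

Lemma path_tree_bij (T : btree) : is_path_tree T -> (2 <= leaves T)%N ->
  exists! s : seq dir, path_tree s = T.
Proof.
have nL s : path_tree s <> Leaf by case: s => [|[] ?].
have inj : injective path_tree.
  elim=> [|[] s IHs] [|[] t] //= [];
  by first [move/IHs-> | move/nL | move/esym/nL].
move=> pT gt1T; suff [s sT] : exists s, path_tree s = T.
  by exists s; split=> // t; rewrite -sT => /inj.
elim: T pT gt1T => [|T1 IH1 T2 IH2] // pT _.
have sub j : (size (level T1 j) + size (level T2 j) <= 2)%N.
  by rewrite -size_cat; apply: (pT j.+1).
have pT1 : is_path_tree T1 by move=> j; apply: leq_trans (leq_addr _ _) (sub j).
have pT2 : is_path_tree T2 by move=> j; apply: leq_trans (leq_addl _ _) (sub j).
have pos U : (0 < leaves U)%N by elim: U => //= U IHU V _; rewrite ltn_addr.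
have gt1 U V : (1 < leaves (Node U V))%N by rewrite /= -addn1 leq_add.
case: T1 T2 IH1 IH2 pT1 pT2 sub {pT} => [|U1 V1] [|U2 V2] IH1 IH2 pT1 pT2 sub.
- by exists [::].
- by have [s sT] := IH2 pT2 (gt1 _ _); exists (dr :: s); rewrite /= sT.
- by have [s sT] := IH1 pT1 (gt1 _ _); exists (dl :: s); rewrite /= sT.
by have := sub 1%N.
Qed.

Definition LeftCombTree (n : nat) : btree := path_tree (nseq (n - 2) dl).

Definition LeftCrookedTree (n : nat) : btree :=
  path_tree (wpow [:: dl; dr] ((n%:R - 2) / 2)).

(* Main.v *)
(* In Z/3 the rules of the grammar say that the label of a vertex is
   -(x + y), where x <> y are the labels of its children.  A comb thus reads a
   word from left to right as an automaton whose state is the label of the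
   subtree read so far.  The crooked tree grows from the middle of the word,
   one letter on the left and one on the right at a time.  For the window of
   the word below a crooked subtree, the state before the window, the label of
   the subtree and the state after it are, up to a permutation of the alphabet,
   determined by the length of the window: each new letter must avoid two
   distinct letters, one imposed by each tree.  Only the last letter escapes
   this, since the root labels of the two trees need not agree: it has to avoid
   the same letter in both, which leaves two words. *)
Require Import Defs.
From mathcomp Require Import all_boot all_order all_algebra all_fingroup.
From mathcomp Require Import classical_sets.
From mathcomp Require Import ring.

Import Order.TTheory GRing.Theory Num.Theory.

Local Open Scope ring_scope.

(** * Fractional powers as prefixes of a periodic word *)

Lemma wpow_frac (A : Type) (x0 : A) (w : seq A) (k : nat) : (0 < size w)%N ->
  wpow w (k%:R / (size w)%:R) = mkseq (fun i => nth x0 w (i %% size w)%N) k.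
Proof.
move=> w0; set m := size w.
have m0 : (0 < m%:R :> rat) by rewrite ltr0n.
have tE : Num.truncn (k%:R / m%:R : rat) = (k %/ m)%N.
  apply: truncn_def; rewrite ler_pdivlMr // ltr_pdivrMr // -!natrM ler_nat ltr_nat.
  by rewrite leq_divM ltn_ceil.
rewrite /wpow tE.
have -> : (size w)%:R * (k%:R / m%:R - (k %/ m)%:R) = (k %% m)%:R :> rat.
  rewrite {1}(divn_eq k m) natrD natrM -/m; field.
  by rewrite gt_eqF.
rewrite natrK.
have {tE} lt_r : (k %% m < m)%N by rewrite ltn_mod.
(* Stating this for arbitrary [q] and [r], instead of the quotient and remainder of [k], lets the
   induction on the number of full copies go through. *)
have bodyE q r : (r < m)%N ->
    flatten (nseq q w) ++ take r w = mkseq (fun i => nth x0 w (i %% m)%N) (q * m + r).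
  move=> ltr; elim: q => [|q IHq].
    rewrite -(mkseq_nth x0 (take r w)) size_takel 1?ltnW //.
    apply/eq_in_map => i; rewrite mem_iota add0n /= => ltir.
    by rewrite nth_take // modn_small // (ltn_trans ltir).
  rewrite /= -catA IHq mulSn -addnA /mkseq (iotaD 0 m) map_cat; congr (_ ++ _).
    rewrite -{1}(mkseq_nth x0 w) -/m; apply/eq_in_map => i.
    by rewrite mem_iota add0n /= => ltim; rewrite modn_small.
  rewrite [(0 + m)%N]addnC iotaDl -map_comp; apply: eq_map => i /=.
  by rewrite modnDl.
by rewrite bodyE // -divn_eq.
Qed.

(** * The grammar as arithmetic in Z/3, and parsing with a prescribed root label *)

Definition parses_at (T : btree) (w : word) (r : 'I_3) : Prop :=
  exists L : ltree, [/\ Defs.shape L = T, frontier L = w, follows_rules L & label L = r].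

Definition third (x y : 'I_3) : 'I_3 := - (x + y).

Ltac letters := repeat match goal with
  x : 'I_3 |- _ => case: x => [[|[|[|?]]] ?] // end.

Lemma mem_grammar (a b c : 'I_3) :
  ((a, b, c) \in grammar) = (b != c) && (a == third b c).
Proof. by letters. Qed.

Lemma third_uniq (x y z : 'I_3) : x != y -> z != x -> z != y -> z = third x y.
Proof. by letters => *; apply/val_inj. Qed.

Lemma thirdK (x y : 'I_3) : third (third x y) x = y.
Proof. by rewrite /third opprD opprK; ring. Qed.

Lemma third_neq (x y : 'I_3) : x != y -> third x y != x.
Proof. by letters. Qed.


Lemma thirdC (x y : 'I_3) : third x y = third y x.
Proof. by rewrite /third addrC. Qed.

Lemma third_neqr (x y : 'I_3) : x != y -> third x y != y.
Proof. by rewrite thirdC eq_sym; apply: third_neq. Qed.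

(** The letter [y] avoids [x] and [third s x], which are distinct, so only [s] is left for it. *)
Lemma third_neq_eq (s x y : 'I_3) : s != x -> x != y -> third s x != y -> s = y.
Proof.
move=> sx xy; case: (eqVneq s y) => // sy /eqP[].
by apply/esym/third_uniq; rewrite // eq_sym.
Qed.

(** With [x] equal to [- k], the letters [x], [1 + x], [2 + x] are the label of the window of
    [k + 1] letters, the state after it and the state before it. *)
Lemma third_step (x : 'I_3) :
  [/\ third x (2 + x) = 1 + x, third (2 + x) (1 + x) = x & third (1 + x) x = 2 + x].
Proof. by letters; split; apply/val_inj. Qed.

Lemma step_neq (x : 'I_3) : [/\ x != 2 + x, 2 + x != 1 + x & 1 + x != x].
Proof. by letters. Qed.

Lemma third_perm (s : {perm 'I_3}) (x y : 'I_3) : x != y ->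
  third (s x) (s y) = s (third x y).
Proof.
move=> xy.
by apply/esym/third_uniq; rewrite ?(inj_eq perm_inj) ?third_neq ?third_neqr.
Qed.

Lemma parses_atP (T : btree) (w : word) : parses T w <-> exists r, parses_at T w r.
Proof.
split=> [[L [? ? ?]]|[r [L [? ? ? _]]]]; last by exists L.
by exists (label L), L.
Qed.

Lemma parses_at_Leaf (w : word) (r : 'I_3) : parses_at Leaf w r <-> w = [:: r].
Proof.
split=> [[[a|a L1 L2] [//= _ <- _ <-]] //|->].
by exists (LLeaf r).
Qed.

Lemma parses_at_Node (T1 T2 : btree) (w : word) (r : 'I_3) :
  parses_at (Node T1 T2) w r <-> exists w1 w2 a b,
    [/\ w = w1 ++ w2, parses_at T1 w1 a, parses_at T2 w2 b, a != b & r = third a b].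
Proof.
split=> [[[a|a L1 L2] [//= [<- <-] <- /and3P[]]]|].
  rewrite mem_grammar => /andP[neq /eqP aE] ? ? <-.
  by exists (frontier L1), (frontier L2), (label L1), (label L2); split=> //;
    [exists L1 | exists L2].
case=> w1 [w2] [a] [b] [-> [L1 [<- <- ok1 <-]] [L2 [<- <- ok2 <-]] neq ->].
exists (LNode (third (label L1) (label L2)) L1 L2).
by rewrite /= mem_grammar neq eqxx ok1 ok2.
Qed.

Lemma parses_at_NodeL (T : btree) (w : word) (r : 'I_3) :
  parses_at (Node T Leaf) w r <->
  exists v a b, [/\ w = rcons v b, parses_at T v a, a != b & r = third a b].
Proof.
rewrite parses_at_Node; split=> [[v] [x] [a] [b] [-> Tv /parses_at_Leaf-> neq ->]|].
  by exists v, a, b; rewrite cats1.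
case=> v [a] [b] [-> Tv neq ->]; exists v, [:: b], a, b.
by split=> //; [rewrite cats1 | apply/parses_at_Leaf].
Qed.

Lemma parses_at_NodeR (T : btree) (w : word) (r : 'I_3) :
  parses_at (Node Leaf T) w r <->
  exists v a b, [/\ w = a :: v, parses_at T v b, a != b & r = third a b].
Proof.
rewrite parses_at_Node; split=> [[x] [v] [a] [b] [-> /parses_at_Leaf-> Tv neq ->]|].
  by exists v, a, b.
case=> v [a] [b] [-> Tv neq ->]; exists [:: a], v, a, b.
by split=> //; apply/parses_at_Leaf.
Qed.

(** * Combs as automata, crooked trees and the core word *)

Fixpoint comb_run (s : 'I_3) (w : word) : bool :=
  if w is x :: w' then (s != x) && comb_run (third s x) w' else true.

Lemma comb_run_rcons (s : 'I_3) (w : word) (x : 'I_3) :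
  comb_run s (rcons w x) = comb_run s w && (foldl third s w != x).
Proof. by elim: w s => [|y w IHw] s /=; rewrite ?andbT // IHw andbA. Qed.

(** The first leaf only sets the initial state, so a comb with [k + 2] leaves makes [k + 1]
    transitions. *)
Lemma parses_comb (k : nat) (w : word) (r : 'I_3) :
  parses_at (path_tree (nseq k dl)) w r <->
  exists a v, [/\ w = a :: v, size v = k.+1, comb_run a v & foldl third a v = r].
Proof.
elim: k w r => [|k IHk] w r /=; rewrite parses_at_NodeL.
  split=> [[v] [a] [b] [-> /parses_at_Leaf-> ab ->]|].
    by exists a, [:: b]; rewrite /= ab.
  case=> a [[|b [|? ?]] [-> //= _ /andP[ab _] <-]].
  by exists [:: a], a, b; split=> //; apply/parses_at_Leaf.
split=> [[v] [c] [b] [-> /IHk[a [u [-> su runu <-]]] ab ->]|].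
  exists a, (rcons u b); rewrite size_rcons su comb_run_rcons runu ab.
  by rewrite foldl_rcons.
case=> a [v]; case/lastP: v => [|u b] [-> //].
rewrite size_rcons comb_run_rcons foldl_rcons => -[su] /andP[runu ab] <-.
exists (a :: u), (foldl third a u), b; split=> //.
by apply/IHk; exists a, u.
Qed.

(** Indexed so that [crooked k] has [k + 1] leaves. Starting from a single leaf and growing two
    levels at a time gives both parities the same induction step, which adds one letter on each
    side. *)
Fixpoint crooked (k : nat) : btree :=
  match k with
  | 0%N => Leaf
  | 1%N => Node Leaf Leaf
  | k'.+2 => Node (Node Leaf (crooked k')) Leaf
  end.

Lemma parses_crookedSS (k : nat) (w : word) (r : 'I_3) :
  parses_at (crooked k.+2) w r <-> exists a c b u,
    [/\ w = a :: rcons c b, parses_at (crooked k) c u, a != u,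
        third a u != b & r = third (third a u) b].
Proof.
rewrite parses_at_NodeL; split.
  move=> [v] [t] [b] [-> /parses_at_NodeR[c [a [u [-> cu au ->]]]] tb ->].
  by exists a, c, b, u.
case=> a [c] [b] [u] [-> cu au tb ->]; exists (a :: c), (third a u), b.
by split=> //; apply/parses_at_NodeR; exists c, a, u.
Qed.

(* The word ...210 012...; modulo 3, its continuation beyond k + 1 letters is
   1 - k on the left and - k on the right, for both parities of k. *)
Fixpoint core (k : nat) : word :=
  match k with
  | 0%N => [:: 0]
  | 1%N => [:: 0; 1]
  | k'.+2 => (1 - k'%:R) :: rcons (core k') (- k'%:R)
  end.

Lemma coreSS (k : nat) : core k.+2 = (1 - k%:R) :: rcons (core k) (- k%:R).
Proof. by []. Qed.

Lemma size_core (k : nat) : size (core k) = k.+1.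
Proof.
have [] : size (core k) = k.+1 /\ size (core k.+1) = k.+2 by
  elim: k => [|k [IH0 IH1]] //=; rewrite size_rcons IH0.
by [].
Qed.

Lemma nat_ind2 (P : nat -> Prop) :
  P 0%N -> P 1%N -> (forall k, P k -> P k.+2) -> forall k, P k.
Proof.
move=> P0 P1 PS k; suff [] : P k /\ P k.+1 by [].
by elim: k => [|k [IH0 IH1]]; split=> //; apply: PS.
Qed.

Lemma natr3 (k : nat) : k.+3%:R = k%:R :> 'I_3.
Proof. by rewrite -[in LHS]addn3 natrD [3%:R](_ : _ = 0) ?addr0 //; apply/val_inj. Qed.

Lemma natrSS (k : nat) : k.+2%:R = k%:R + 2 :> 'I_3.
Proof. by rewrite -[in LHS]addn2 natrD. Qed.

(** The existence half. The three facts are proved together: whether the two outer letters are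
    admissible depends on the label and the exit state of the inner window. *)
Lemma core_spec (k : nat) :
  [/\ parses_at (crooked k) (core k) (- k%:R),
      comb_run (2 - k%:R) (core k) &
      foldl third (2 - k%:R) (core k) = 1 - k%:R].
Proof.
elim/nat_ind2: k => [||k [IHp IHr IHf]].
- split=> //; last exact/val_inj.
  by apply/parses_at_Leaf; congr [:: _]; apply/val_inj.
- split=> //; last exact/val_inj.
  apply/parses_at_NodeR; exists [:: 1], 0, 1.
  by split=> //; [apply/parses_at_Leaf | apply/val_inj].
(* The label in the crooked tree once the left letter is attached. *)
have E0 : third (1 - k%:R) (- k%:R) = 2 - k%:R.
  by move: (k%:R : 'I_3) => x; letters; apply/val_inj.
(* Reading the left letter brings the comb to the entry state of the inner window. *)
have E1 : third (2 - k.+2%:R) (1 - k%:R) = 2 - k%:R.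
  by rewrite (natrSS k); move: (k%:R : 'I_3) => x; letters; apply/val_inj.
split.
- apply/parses_crookedSS; exists (1 - k%:R), (core k), (- k%:R), (- k%:R).
  rewrite E0; split=> //; rewrite ?(natrSS k); move: (k%:R : 'I_3) => x; letters.
  all: try by apply/val_inj.
- rewrite /= comb_run_rcons E1 IHr IHf /= (natrSS k).
  by move: (k%:R : 'I_3) => x; letters.
rewrite /= foldl_rcons E1 IHf (natrSS k).
by move: (k%:R : 'I_3) => x; letters; apply/val_inj.
Qed.

(** * Uniqueness of the core up to a permutation of the alphabet *)

Lemma perm_of_neq (x y z x' y' z' : 'I_3) : x != y -> z != x -> z != y ->
   x' != y' -> z' != x' -> z' != y' ->
  exists g : {perm 'I_3}, [/\ g x = x', g y = y' & g z = z'].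
Proof.
move=> xy zx zy xy' zx' zy'.
pose f t := if t == x then x' else if t == y then y' else z'.
have E := (eqxx, eq_sym y x, eq_sym x z, eq_sym y z, negPf xy, negPf zx, negPf zy).
have E' := (eq_sym y' x', eq_sym x' z', eq_sym y' z', negPf xy', negPf zx', negPf zy').
have f_inj : injective f.
  (* Three distinct letters exhaust the alphabet. *)
  have t3 t : [|| t == x, t == y | t == z].
    case: (eqVneq t x) => //= tx; case: (eqVneq t y) => //= ty.
    by rewrite (third_uniq _ _ _ xy tx ty) -(third_uniq _ _ _ xy zx zy).
  move=> s t; rewrite /f; case/or3P: (t3 s) => /eqP->; case/or3P: (t3 t) => /eqP->;
    by rewrite ?E // => /eqP; rewrite ?E'.
by exists (perm f_inj); rewrite !permE /f ?E.
Qed.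

(** The base cases choose [g], and the induction step keeps it: the inner window fixes [g], and each
    outer letter must avoid two distinct images under [g], hence is the third one. *)
Lemma core_unique (k : nat) (c : word) (s u : 'I_3) :
  parses_at (crooked k) c u -> comb_run s c ->
  exists g : {perm 'I_3},
    [/\ c = map g (core k), s = g (2 - k%:R), u = g (- k%:R) &
        foldl third s c = g (1 - k%:R)].
Proof.
elim/nat_ind2: k c s u => [||k IHk] c s u.
- move=> /parses_at_Leaf-> /= /andP[su _].
  have [g [g2 g0 g1]] := perm_of_neq 2 0 1 s u (third s u) isT isT isT
    su (third_neq _ _ su) (third_neqr _ _ su).
  by exists g; rewrite !subr0 oppr0 g0 g1 g2.
- move=> /parses_at_NodeR[v [a [b [-> /parses_at_Leaf-> ab ->]]]].
  rewrite /= => /and3P[sa tb _].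
  have sb := third_neq_eq _ _ _ sa ab tb.
  have [g [g0 g1 g2]] := perm_of_neq 0 1 2 a b (third a b) isT isT isT
    ab (third_neq _ _ ab) (third_neqr _ _ ab).
  by rewrite sb thirdK; exists g; rewrite -g2 -g0 -g1; split=> //; congr (g _);
    apply/val_inj.
move=> /parses_crookedSS[a [d [b [t [-> dt neq_at neq_b ->]]]]].
rewrite /= comb_run_rcons foldl_rcons => /and3P[sa rund].
have [g [-> sE tE ->]] := IHk _ _ _ dt rund.
(* Passing from [k] to [k + 2] only rotates the three residues, so everything can be written in
   terms of [x] equal to [- k]. *)
have -> : 2 - k.+2%:R = - k%:R :> 'I_3.
  by rewrite (natrSS k) opprD addrCA subrr addr0.
have -> : 1 - k.+2%:R = 2 - k%:R :> 'I_3.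
  by rewrite (natrSS k) opprD addrCA addrC; congr (_ + _); apply/val_inj.
have -> : - k.+2%:R = 1 - k%:R :> 'I_3.
  by rewrite (natrSS k) opprD addrC; congr (_ + _); apply/val_inj.
move: (- k%:R) sE tE neq_at neq_b => x sE -> neq_at neq_b neq_bf.
have [t0 t1 t2] := third_step x; have [n0 n1 n2] := step_neq x.
(* The left letter avoids the label [g x] in the crooked tree, and the state [g (2 + x)] that it
   produces in the comb. *)
have aE : a = g (1 + x).
  rewrite -t0 -third_perm //; apply: third_uniq => //; first by rewrite (inj_eq perm_inj).
  by rewrite -sE eq_sym third_neqr.
move: neq_b; rewrite aE third_perm // t2 => neq_b.
(* The right letter avoids [g (2 + x)] in the crooked tree and the exit state [g (1 + x)] in the
   comb. *)
have bE : b = g x.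
  rewrite -t1 -third_perm //; apply: third_uniq; rewrite ?[b == _]eq_sym //.
  by rewrite (inj_eq perm_inj).
exists g; rewrite bE map_rcons third_perm 1?eq_sym // third_perm // t2.
rewrite [third (2 + x) _]thirdC t0; split=> //.
(* The state before [a] is recovered from [a] and the state after it. *)
by rewrite -(thirdK a s) [third a s]thirdC sE aE third_perm // t1.
Qed.

(** * Closed forms of the words and trees *)

Lemma w012_mod3 (i : nat) : nth 0 w012 (i %% 3)%N = i%:R.
Proof.
rewrite {2}(divn_eq i 3) natrD natrM [3%:R](_ : _ = 0); last exact/val_inj.
rewrite mulr0 add0r; have : (i %% 3 < 3)%N by rewrite ltn_mod.
by case: (i %% 3)%N => [|[|[|]]] // _; apply/val_inj.
Qed.

Lemma wpow_w012 (x : rat) (j : nat) : x = j%:R / 3 ->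
  wpow w012 x = mkseq (fun i => i%:R) j.
Proof.
move=> ->; rewrite (wpow_frac _ 0 w012 j isT).
by apply: eq_map => i; rewrite w012_mod3.
Qed.

Lemma mod3_intr (z : int) : mod3 z = z%:~R.
Proof.
have z3 : (3 : 'I_3) = 0 by apply/val_inj.
rewrite /mod3 [in RHS](divz_eq z 3) rmorphD rmorphM /= [3%:~R]z3 mulr0 add0r.
have : (0 <= z %% 3)%Z by apply: modz_ge0.
have : (z %% 3 < 3)%Z by apply: ltz_pmod.
case: (z %% 3)%Z => [[|[|[|]]]|] // _ _; apply/val_inj; by rewrite /= inordK.
Qed.

(** Since [-2 = 1] in Z/3, the letters added to [core j.*2] are [j + 1] and [j], and those added to
    [core j.*2.+1] are [j] and [j + 2]. *)
Lemma core_double (j : nat) :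
  core j.*2 = rev (mkseq (fun i => i%:R) j.+1) ++ mkseq (fun i => i%:R) j /\
  core j.*2.+1 = rev (mkseq (fun i => i%:R) j) ++ mkseq (fun i => i%:R) j.+2.
Proof.
have double1 i : 1 - i.*2%:R = i.+1%:R :> 'I_3.
  rewrite -muln2 natrM -(addn1 i) natrD; move: (i%:R : 'I_3) => x.
  by letters; apply/val_inj.
have double2 i : - i.*2%:R = i%:R :> 'I_3.
  by rewrite -muln2 natrM; move: (i%:R : 'I_3) => x; letters; apply/val_inj.
elim: j => [|j [IH0 IH1]]; first by [].
split; rewrite doubleS coreSS.
  rewrite IH0 double1 double2.
  by rewrite (mkseqS _ j.+1) (mkseqS _ j) !rev_rcons rcons_cat.
rewrite IH1 -natr1 opprD addrCA subrr addr0 double2.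
rewrite (mkseqS _ j.+2) (mkseqS _ j) rev_rcons rcons_cat cat_cons.
congr (_ :: _ ++ rcons _ _).
by rewrite (natrSS j); congr (_ + _); apply/val_inj.
Qed.

Lemma path_tree_crooked (k : nat) :
  path_tree (mkseq (fun i => nth dl [:: dl; dr] (i %% 2)%N) k) = crooked k.+1.
Proof.
elim/nat_ind2: k => [||k IHk] //.
rewrite -[crooked _]/(Node (Node Leaf (crooked k.+1)) Leaf) -IHk.
rewrite /mkseq (iotaD 0 2 k) /= -[(0 + 2)%N]/(2 + 0)%N iotaDl -map_comp.
congr (Node (Node _ _) _); congr path_tree; apply: eq_map => i /=; rewrite (modnDl 2).
Qed.

Lemma LeftCrookedTreeE (k : nat) : LeftCrookedTree k.+3 = crooked k.+2.
Proof.
rewrite /LeftCrookedTree -path_tree_crooked -(wpow_frac _ dl [:: dl; dr] k.+1 isT).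
by congr (path_tree (wpow _ (_ / _))); rewrite -addn2 natrD addrK.
Qed.

(** * Classes of common words *)

Lemma word_class_perm (g : {perm 'I_3}) (w : word) :
  word_class (map g w) = word_class w.
Proof.
apply/seteqP; split=> v [s ->]; rewrite /word_class /=.
  by exists (g * s)%g; rewrite -map_comp; apply: eq_map => x /=; rewrite permM.
exists (g^-1 * s)%g; rewrite -map_comp; apply: eq_map => x /=.
by rewrite permM permK.
Qed.

(** The core is the word without its first and last letters. The forbidden last letter [1 - k] is
    both the exit state of the comb and the label of the left child of the root in the crooked
    tree. *)
Lemma ParseWords_core (k : nat) :
  ParseWords (LeftCombTree k.+3) (LeftCrookedTree k.+3) =
  [set word_class ((2 - k%:R) :: rcons (core k) (2 - k%:R));
       word_class ((2 - k%:R) :: rcons (core k) (- k%:R))]%classic.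
Proof.
rewrite LeftCrookedTreeE /LeftCombTree (_ : (k.+3 - 2)%N = k.+1) //.
have [n0 n1 n2] := step_neq (- k%:R); have [t0 t1 t2] := third_step (- k%:R).
apply/seteqP; split=> C.
  case=> w [/parses_atP[q /parses_comb[a [v [-> _ run _]]]]].
  move=> /parses_atP[r /parses_crookedSS[a' [c [b [u [[<- vE] cu _ _ _]]]]]] <-.
  move: run; rewrite vE comb_run_rcons => /andP[run].
  have [g [-> -> _ ->]] := core_unique _ _ _ _ cu run => neq_b.
  have wE x : g (2 - k%:R) :: rcons (map g (core k)) (g x) =
      map g ((2 - k%:R) :: rcons (core k) x) by rewrite /= map_rcons.
  case: (eqVneq b (g (- k%:R))) => [->|neq_b0].
    by right; rewrite wE word_class_perm.
  left; rewrite -(word_class_perm g) -wE; congr (word_class (_ :: rcons _ _)).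
  rewrite -t2 -third_perm //; apply: third_uniq; rewrite // 1?eq_sym //.
  by rewrite (inj_eq perm_inj) eq_sym.
have [cp cr cf] := core_spec k.
have parsed b : b != 1 - k%:R ->
  ParseWords (path_tree (nseq k.+1 dl)) (crooked k.+2)
    (word_class ((2 - k%:R) :: rcons (core k) b)).
  move=> neq_b; exists ((2 - k%:R) :: rcons (core k) b) => //; split.
    apply/parses_atP; eexists; apply/parses_comb.
    exists (2 - k%:R), (rcons (core k) b).
    by rewrite size_rcons size_core comb_run_rcons cr cf eq_sym neq_b.
  apply/parses_atP; eexists; apply/parses_crookedSS.
  exists (2 - k%:R), (core k), b, (- k%:R).
  by rewrite [third _ _]thirdC t0 eq_sym n0 eq_sym neq_b.
by case=> ->; apply: parsed; rewrite // eq_sym.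
Qed.

Theorem theorem7 (n : nat) (hn : (3 <= n)%N) :
  (odd n ->
     ParseWords (LeftCombTree n) (LeftCrookedTree n) =
     [set word_class
            ([:: mod3 (2 - n%:Z)]
             ++ rev (wpow w012 ((n%:R - 1) / 6))
             ++ wpow w012 ((n%:R - 3) / 6)
             ++ [:: mod3 (2 - n%:Z)]);
          word_class
            ([:: mod3 (2 - n%:Z)]
             ++ rev (wpow w012 ((n%:R - 1) / 6))
             ++ wpow w012 ((n%:R - 3) / 6)
             ++ [:: mod3 (- n%:Z)])]%classic) /\
  ((4 <= n)%N -> ~~ odd n ->
     ParseWords (LeftCombTree n) (LeftCrookedTree n) =
     [set word_class
            ([:: mod3 (2 - n%:Z)]
             ++ rev (wpow w012 ((n%:R - 4) / 6))
             ++ wpow w012 (n%:R / 6)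
             ++ [:: mod3 (2 - n%:Z)]);
          word_class
            ([:: mod3 (2 - n%:Z)]
             ++ rev (wpow w012 ((n%:R - 4) / 6))
             ++ wpow w012 (n%:R / 6)
             ++ [:: mod3 (- n%:Z)])]%classic).
Proof.
case: n hn => [|[|[|k]]] // _; rewrite ParseWords_core.
have -> : mod3 (2 - k.+3%:Z) = 2 - k%:R.
  by rewrite mod3_intr rmorphB -(natr3 k).
have -> : mod3 (- k.+3%:Z) = - k%:R by rewrite mod3_intr rmorphN -(natr3 k).
have := odd_double_half k; move: (k./2) => j kE; have [core0 core1] := core_double j.
split=> [|_] /=; rewrite !negbK => odd_k; move: kE.
  (* Here [n = 2j + 3], and the exponents are [(j + 1) / 3] and [j / 3]. *)
  rewrite (negPf odd_k) add0n => <-.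
  rewrite (wpow_w012 _ j.+1); last first.
    by rewrite -addn3 -muln2 -(addn1 j) !natrD natrM; field.
  rewrite (wpow_w012 _ j); last first.
    by rewrite -addn3 -muln2 !natrD natrM; field.
  by rewrite core0 -!cats1 !catA.
(* Here [n = 2j + 4], and the exponents are [j / 3] and [(j + 2) / 3]. *)
rewrite odd_k add1n => <-.
rewrite (wpow_w012 _ j); last first.
  by rewrite -addn4 -muln2 !natrD natrM; field.
rewrite (wpow_w012 _ j.+2); last first.
  by rewrite -addn4 -muln2 -(addn2 j) !natrD natrM; field.
by rewrite core1 -!cats1 !catA.
Qed.
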